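(* Let $\mathbb{K}$ be a field, let $n\geq 3$ be an integer, put $N=n+1$, and let $I_{D_n}\subset \mathbb{K}[x_0,x_1,\ldots,x_n,x_N]$ be the Stanley-Reisner ideal of the bipyramidal graph $D_n$ (regarded as a simplicial complex of dimension one). Then its Waldschmidt constant is $$\widehat{\alpha}(I_{D_n})=\frac{n+2}{n}.$$
   Context: Bipyramidal graph: for an integer $n\geq 3$ and $N=n+1$, $D_n$ is the graph with vertex set $V=\{P_0,P_1,\ldots,P_n,P_N\}$ (so $n+2$ vertices) and edge set consisting of: $P_0P_i$ and $P_NP_i$ for $i=1,\ldots,n$; the edges of the $n$-cycle $P_1P_2,\,P_2P_3,\ldots,P_{n-1}P_n,\,P_nP_1$; and the edge $P_0P_N$. The vertex $P_i$ is identified with the index $i\in\{0,1,\ldots,N\}$. Simplicial complex: a simplicial complex $\Delta$ on a finite set $V$ is a collection of subsets of $V$ such that $\sigma\in\Delta$ and $\tau\subset\sigma$ imply $\tau\in\Delta$. The graph $D_n$ is viewed as the simplicial complex on $\{0,1,\ldots,N\}$ whose elements are the empty set, all singletons $\{i\}$, and all pairs $\{i,j\}$ such that $P_iP_j$ is an edge of $D_n$ (no subsets with three or more elements). Stanley-Reisner ideal: for $\sigma\subset\{0,1,\ldots,N\}$ put $x_\sigma=\prod_{i\in\sigma}x_i\in\mathbb{K}[x_0,\ldots,x_N]$. The Stanley-Reisner ideal of $\Delta$ is $I_\Delta=\langle x_\tau : \tau\subset\{0,\ldots,N\},\ \tau\notin\Delta\rangle$. Symbolic powers: for a homogeneous ideal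 $I$ in $R=\mathbb{K}[x_0,\ldots,x_N]$ and $m\geq 0$, the $m$-th symbolic power is $I^{(m)}=\bigcap_{P\in\mathrm{Ass}(I)}\left(I^mR_P\cap R\right)$, where $\mathrm{Ass}(I)$ is the set of associated primes of $I$. Waldschmidt constant: for a nonzero homogeneous ideal $I$, $\alpha(I)$ denotes the smallest degree of a nonzero element of $I$ (initial degree), and the Waldschmidt constant of $I$ is $\widehat{\alpha}(I)=\lim_{m\to\infty}\frac{\alpha(I^{(m)})}{m}$ (the limit exists and equals $\inf_{m\geq 1}\frac{\alpha(I^{(m)})}{m}$). *)

(* Defs.v *)
(* mpoly must be imported before the MathComp-Analysis files: in the other
   order their notations clash. *)
From HB Require Import structures.
From mathcomp Require Import all_boot all_order all_algebra fraction.
From mathcomp Require Import mpoly.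
From mathcomp Require Import boolp classical_sets reals topology normedtype.
From mathcomp Require Import sequences.

Set Implicit Arguments.
Unset Strict Implicit.
Unset Printing Implicit Defensive.

Import GRing.Theory numFieldNormedType.Exports.

Local Open Scope classical_set_scope.
Local Open Scope ring_scope.

Section Ideals.
Variable A : comNzRingType.
Implicit Types (I P S : set A).

(* Unlike [idealr_closed], this allows the unit ideal (e.g. [I ^ 0]). *)
Definition is_ideal I : Prop :=
  [/\ I 0, (forall f g, I f -> I g -> I (f + g))
    & (forall f g, I g -> I (f * g))].

Definition ideal_gen S : set A := smallest is_ideal S.

Definition ideal_power I (m : nat) : set A :=
  ideal_gen [set f | exists2 g : 'I_m -> A,
                       (forall i, I (g i)) & f = \prod_i g i].

Definition is_prime_ideal P : Prop :=
  [/\ is_ideal P, ~ P 1 & forall f g, P (f * g) -> P f \/ P g].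

(* [P] is associated to [I] when it is prime and is the annihilator
   [(I : f)] of the class of some [f] in [A / I]. *)
Definition associated_primes I : set (set A) :=
  [set P | is_prime_ideal P /\ exists f, P = [set g | I (g * f)]].

End Ideals.

Section SymbolicPower.
Variable A : idomainType.
Implicit Types (I P : set A).

(* Since [A] is a domain, the local ring [A_P] is realised inside the field of
   fractions of [A]. *)
Definition localization P : set {fraction A} :=
  [set x | exists a s, ~ P s /\ x = tofrac a / tofrac s].

(* the ideal [I A_P] of [A_P] *)
Definition extended_ideal I P : set {fraction A} :=
  [set x | exists k (r : 'I_k -> {fraction A}) (a : 'I_k -> A),
     [/\ (forall i, localization P (r i)), (forall i, I (a i))
       & x = \sum_i r i * tofrac (a i)]].

(* [I A_P] contracted to [A] *)
Definition contracted_ideal I P : set A :=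
  [set f | extended_ideal I P (tofrac f)].

Definition symbolic_power I (m : nat) : set A :=
  \bigcap_(P in associated_primes I) contracted_ideal (ideal_power I m) P.

End SymbolicPower.

Section Waldschmidt.
Variables (K : fieldType) (v : nat).
Implicit Types (I : set {mpoly K[v]}).

(* [msize f] is one more than the total degree of [f] when [f != 0]. *)
Definition is_initial_degree I (d : nat) : Prop :=
  (exists f, [/\ I f, f != 0 & (msize f).-1 = d]) /\
  (forall f, I f -> f != 0 -> (d <= (msize f).-1)%N).

(* junk value 0 for the zero ideal *)
Definition initial_degree I : nat :=
  xget 0%N [set d | is_initial_degree I d].

Definition waldschmidt_seq (R : realType) I : nat -> R :=
  fun m => (initial_degree (symbolic_power I m))%:R / m%:R.

Definition waldschmidt_constant (R : realType) I : R :=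
  limn (waldschmidt_seq R I).

End Waldschmidt.

Section StanleyReisner.
Variable V : finType.

Definition simplicial_complex (D : {set {set V}}) : Prop :=
  forall s t : {set V}, s \in D -> t \subset s -> t \in D.

Definition graph_complex (e : rel V) : {set {set V}} :=
  [set s | [|| s == finset.set0, [exists i, s == [set i]%SET]
             | [exists i, exists j, e i j && (s == [set i; j]%SET)]]].

Lemma graph_complexP (e : rel V) : simplicial_complex (graph_complex e).
Proof.
move=> s t; rewrite !inE => /or3P[/eqP-> | /existsP[i /eqP->] |].
- by rewrite finset.subset0 => ->.
- by rewrite finset.subset1 => /orP[ti | ->] //; apply/or3P/Or32/existsP; exists i.
move=> /existsP[i /existsP[j /andP[eij /eqP->]]] ts.
have sub1 k l : t \subset [set k; l]%SET -> k \notin t ->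
    (t == finset.set0) || [exists i, t == [set i]%SET].
  move=> tkl kt; have : t \subset [set l]%SET.
    apply/fintype.subsetP => x xt; move: (fintype.subsetP tkl x xt); rewrite !inE.
    by case: eqVneq xt kt => [-> -> //|].
  rewrite finset.subset1 => /orP[tl|->//].
  by apply/orP; right; apply/existsP; exists l.
have [it|/(sub1 _ _ ts)] := boolP (i \in t); last by rewrite orbA => ->.
have [jt|jt] := boolP (j \in t); last first.
  by rewrite orbA (sub1 j i) // finset.setUC.
apply/or3P/Or33/existsP; exists i; apply/existsP; exists j.
by rewrite eij finset.eqEsubset ts finset.subUset !finset.sub1set it jt.
Qed.

End StanleyReisner.

Definition set_monomial (K : fieldType) (v : nat) (s : {set 'I_v}) :
  {mpoly K[v]} := \prod_(i in s) 'X_i.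

Definition stanley_reisner_ideal (K : fieldType) (v : nat)
    (D : {set {set 'I_v}}) : set {mpoly K[v]} :=
  ideal_gen [set f | exists2 t : {set 'I_v}, t \notin D & f = set_monomial K t].

Arguments stanley_reisner_ideal K {v} D.

(* The two apexes are 0 and [N = n + 1], and 1, ..., n is the base cycle; each
   edge is listed in one orientation. *)
Definition bipyramid_arc (n i j : nat) : bool :=
  [|| (i == 0%N) && (1 <= j <= n)%N,
      (i == n.+1) && (1 <= j <= n)%N,
      [&& (1 <= i)%N, (i < n)%N & j == i.+1],
      (i == n) && (j == 1%N)
    | (i == 0%N) && (j == n.+1)].

Definition bipyramid_edge (n : nat) : rel 'I_n.+2 :=
  fun i j => bipyramid_arc n i j || bipyramid_arc n j i.

Definition bipyramid_complex (n : nat) : {set {set 'I_n.+2}} :=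
  graph_complex (@bipyramid_edge n).

(* Main.v *)
Require Import Defs.
From mathcomp Require Import all_boot all_order all_algebra.
From mathcomp Require Import fraction.
From mathcomp Require Import mpoly.
From mathcomp Require Import boolp classical_sets reals topology normedtype.
From mathcomp Require Import sequences.
From mathcomp Require Import zify ring.

Import GRing.Theory Num.Theory Order.TTheory.
Import numFieldNormedType.Exports.
Local Open Scope classical_set_scope.
Local Open Scope ring_scope.

Set Implicit Arguments.
Unset Strict Implicit.
Unset Printing Implicit Defensive.

(** The ideal [I] of $D_n$ is the intersection of the primes $P_s$ generated
    by the variables outside $s$, for $s$ a facet, and $I^{(m)}$ is the
    intersection of the $P_s^m$. So a polynomial lies in $I^{(m)}$ exactly when
    each of its monomials $x^a$ satisfies $\sum_{i \notin s} a_i \geq m$ for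
    every facet $s$. This holds for every simplicial complex
    ([symbolic_power_stanley_reisner]) and turns the Waldschmidt constant into
    the value of a linear program on exponent vectors.

    Two facts relate the symbolic power, defined through associated primes, to
    the facets. For a facet $s$, the prime $P_s$ is $(I : x_s)$, hence
    associated ([facet_associated]), and its powers are primary
    ([face_prime_power_cancel]), so passing to the localization and back adds
    nothing to $P_s^m$. Conversely an associated prime avoids $x_s$ for some
    facet $s$ ([associated_prime_avoids_facet]), and in that localization every
    variable outside $s$ belongs to the extension of $I$.

    For $D_n$ the facets are edges, so $x_0 \cdots x_N$ has degree $n$ outside
    each facet and its powers give initial degree at most about $m (n + 2) / n$.
    For the lower bound, the vertices $0, 1, \ldots, N$ in this order form a
    Hamiltonian cycle; each vertex is outside exactly $n$ of its $n + 2$ edges,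
    so summing the $n + 2$ inequalities gives $n |a| \geq m (n + 2)$
    ([sum_outside_degree_cycle]). The two bounds differ by a constant, and
    dividing by $m$ squeezes the sequence to $(n + 2) / n$. *)

(** * Ideals and localization *)

Section IdealFacts.
Variable A : comNzRingType.
Implicit Types (I S : set A).

Lemma ideal_gen_ideal S : is_ideal (ideal_gen S).
Proof.
split.
- by move=> J [[J0 _ _] _].
- move=> f g If Ig J SJ; have [[_ JD _] _] := SJ.
  by apply: JD; [apply: If | apply: Ig].
- move=> f g Ig J SJ; have [[_ _ JM] _] := SJ.
  by apply: JM; apply: Ig.
Qed.

Lemma ideal_gen_sub S : S `<=` ideal_gen S.
Proof. exact: sub_gen_smallest. Qed.

Lemma ideal_gen_min S I : is_ideal I -> S `<=` I -> ideal_gen S `<=` I.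
Proof. by move=> idI SI; apply: smallest_sub. Qed.

Lemma ideal_sum I (T : Type) (r : seq T) (F : T -> A) (Q : pred T) :
  is_ideal I -> (forall i, Q i -> I (F i)) -> I (\sum_(i <- r | Q i) F i).
Proof. by case=> I0 ID _ IF; apply: (big_ind I). Qed.

Lemma ideal_power0 I f : ideal_power I 0 f.
Proof.
have [_ _ IM] := ideal_gen_ideal
  [set f | exists2 g : 'I_0 -> A, (forall i, I (g i)) & f = \prod_i g i].
rewrite -[f]mulr1; apply: IM; apply: ideal_gen_sub.
by exists (fun=> 0) => [[]//|]; rewrite big_ord0.
Qed.

Lemma ideal_powerS I m f g :
  I f -> ideal_power I m g -> ideal_power I m.+1 (f * g).
Proof.
move=> If; have [J0 JD JM] := ideal_gen_ideal
  [set f | exists2 g : 'I_m.+1 -> A, (forall i, I (g i)) & f = \prod_i g i].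
pose J : set A := [set g | ideal_power I m.+1 (f * g)].
suff: ideal_power I m `<=` J by apply.
apply: ideal_gen_min.
  split=> [|h k Jh Jk|h k Jk]; rewrite /J /=.
  - by rewrite mulr0.
  - by rewrite mulrDr; apply: JD.
  - by rewrite mulrCA; apply: JM.
move=> _ [h Ih ->]; apply: ideal_gen_sub.
(* The new factor takes index 0 and the old ones are shifted. *)
exists (fun i => if unlift ord0 i is Some j then h j else f).
  by move=> i; case: unlift.
rewrite big_ord_recl unlift_none; congr (f * _).
by apply: eq_bigr => i _; rewrite liftK.
Qed.

Lemma prime_ideal_prod (P : set A) (T : Type) (r : seq T) (Q : pred T)
    (F : T -> A) : is_prime_ideal P ->
  (forall i, Q i -> ~ P (F i)) -> ~ P (\prod_(i <- r | Q i) F i).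
Proof.
case=> _ P1 PM PF; apply: (big_ind (fun x => ~ P x)) => // x y Px Py.
by case/PM.
Qed.

Lemma prime_ideal_expr (P : set A) f m :
  is_prime_ideal P -> ~ P f -> ~ P (f ^+ m).
Proof.
by move=> Pp Pf; rewrite -[m]card_ord -prodr_const; apply: prime_ideal_prod.
Qed.

End IdealFacts.

(** Clearing denominators: the finitely many denominators of an element of the
    extended ideal are merged into one element outside the prime. *)
Lemma contracted_idealP (A : idomainType) (J P : set A) (f : A) :
  is_ideal J -> is_prime_ideal P ->
  contracted_ideal J P f <-> exists2 s, ~ P s & J (s * f).
Proof.
move=> [J0 JD JM] [[P0 _ _] P1 PM].
have nz s : ~ P s -> tofrac s != 0.
  by move=> Ps; rewrite -tofrac0 tofrac_eq; apply: contra_notN Ps => /eqP->.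
split=> [[k [r [a [Pr Ja fE]]]] | [s Ps Jsf]]; last first.
  exists 1%N, (fun=> (tofrac s)^-1), (fun=> s * f); split=> //.
    by move=> _; exists 1, s; rewrite tofrac1 mul1r.
  by rewrite big_ord1 tofracM mulKf // nz.
suff [s [c [Ps Jc sE]]] : exists s c,
    [/\ ~ P s, J c & tofrac s * \sum_i r i * tofrac (a i) = tofrac c].
  exists s => //; suff -> : s * f = c by [].
  by apply/eqP; rewrite -tofrac_eq tofracM fE sE.
elim: k r a Pr Ja {fE} => [|k IHk] r a Pr Ja.
  by exists 1, 0; split; rewrite // big_ord0 mulr0 tofrac0.
have [s [c [Ps Jc sE]]] := IHk (fun i => r (lift ord0 i))
  (fun i => a (lift ord0 i)) (fun i => Pr _) (fun i => Ja _).
have [b [t [Pt rE]]] := Pr ord0.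
exists (t * s), (s * b * a ord0 + t * c); split.
- by case/PM.
- by apply: JD; apply: JM.
rewrite big_ord_recl mulrDr tofracD !tofracM -[X in _ + X]mulrA sE.
congr (_ + _).
have -> : tofrac b = tofrac t * r ord0 by rewrite rE mulrC divfK ?nz.
by rewrite !mulrA [tofrac s * _]mulrC.
Qed.

(** * Monomials and their degree outside a face *)

Section Monomials.
Variables (K : fieldType) (v : nat).
Implicit Types (s t : {set 'I_v}) (a b : 'X_{1..v}) (f g : {mpoly K[v]}).

Definition mnm_support a : {set 'I_v} := [set i | a i != 0%N]%SET.

Definition outside_degree s a : nat := \sum_(i in ~: s) a i.

Lemma mnm_supportD a b :
  mnm_support (a + b)%MM = (mnm_support a :|: mnm_support b)%SET.
Proof. by apply/setP=> i; rewrite !inE mnmDE addn_eq0 negb_and. Qed.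

Lemma mnm_support1 i : mnm_support U_(i)%MM = [set i]%SET.
Proof. by apply/setP=> j; rewrite !inE mnm1E eqb0 negbK eq_sym. Qed.

Lemma outside_degreeD s a b :
  outside_degree s (a + b)%MM = (outside_degree s a + outside_degree s b)%N.
Proof. by rewrite -big_split; apply: eq_bigr => i _; rewrite mnmDE. Qed.

Lemma outside_degree_le_mdeg s a : (outside_degree s a <= mdeg a)%N.
Proof.
by rewrite mdegE [leqRHS](bigID (fun i => i \in ~: s)%SET) leq_addr.
Qed.

Lemma outside_degree_gt0 s a :
  (0 < outside_degree s a)%N = ~~ (mnm_support a \subset s).
Proof.
rewrite lt0n sum_nat_eq0 negb_forall.
apply/existsP/fintype.subsetPn => [[i]|[i]]; rewrite ?inE.
  by rewrite negb_imply => /andP[si ai]; exists i; rewrite ?inE.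
by move=> ai si; exists i; rewrite negb_imply !inE si.
Qed.

Definition indicator_mnm s : 'X_{1..v} := [multinom (i \in s : nat) | i < v]%MM.

Lemma mnm_support_indicator s : mnm_support (indicator_mnm s) = s.
Proof. by apply/setP=> i; rewrite inE mnmE eqb0 negbK. Qed.

Lemma set_monomialE s : set_monomial K s = 'X_[indicator_mnm s].
Proof.
rewrite mpolyXE_id /set_monomial big_mkcond /=; apply: eq_bigr => i _.
by rewrite mnmE; case: (i \in s).
Qed.

(** The $m$-th power of the prime generated by the variables outside [s],
    described by its monomials. *)
Definition face_prime_power s m : set {mpoly K[v]} :=
  [set f | forall a, a \in msupp f -> (m <= outside_degree s a)%N].

Lemma face_prime_power_ideal s m : is_ideal (face_prime_power s m).
Proof.
split=> [a|f g If Ig a|f g Ig a]; first by rewrite msupp0.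
  by move/msuppD_le; rewrite mem_cat => /orP[/If|/Ig].
move/msuppM_le/allpairsP => [[b c] /= [_ cg ->]].
by rewrite outside_degreeD (leq_trans (Ig c cg)) ?leq_addl.
Qed.

Lemma face_prime_powerM s m k f g : face_prime_power s m f ->
  face_prime_power s k g -> face_prime_power s (m + k) (f * g).
Proof.
move=> If Ig a /msuppM_le/allpairsP [[b c] /= [bf cg ->]].
by rewrite outside_degreeD leq_add ?If ?Ig.
Qed.

Lemma face_prime_power_ideal_power s (I : set {mpoly K[v]}) m :
  I `<=` face_prime_power s 1 -> ideal_power I m `<=` face_prime_power s m.
Proof.
move=> Is; apply: ideal_gen_min; first exact: face_prime_power_ideal.
move=> _ [h Ih ->]; elim: m h Ih => [|m IHm] h Ih; first by [].
rewrite big_ord_recl; apply: (@face_prime_powerM s 1 m); first exact/Is.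
by apply: IHm => i; apply: Ih.
Qed.

(** Attaching a new indeterminate to each variable outside [s] makes the
    outside degree visible as the exponent of that indeterminate. *)
Definition grade_outside s : {mpoly K[v]} -> {poly {mpoly K[v]}} :=
  mmap (polyC \o @mpolyC v K)
    (fun i => ('X_i : {mpoly K[v]})%:P * 'X^(i \notin s)).

Lemma coef_grade_outside s f d a :
  (grade_outside s f)`_d@_a = f@_a *+ (outside_degree s a == d).
Proof.
have gX b :
    mmap1 (fun i => ('X_i : {mpoly K[v]})%:P * 'X^(i \notin s)) b =
    ('X_[K, b])%:P * 'X^(outside_degree s b).
  rewrite /mmap1; under eq_bigr do rewrite exprMn -exprM.
  rewrite big_split /= mpolyXE_id rmorph_prod; congr (_ * _).
    by apply: eq_bigr => i _; rewrite rmorphXn.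
  rewrite prodrXr /outside_degree [in RHS]big_mkcond /=; congr (_ ^+ _).
  apply: eq_bigr => i _.
  by rewrite inE; case: (i \in s); rewrite ?mul0n ?mul1n.
have fE : f@_a = \sum_(b <- msupp f) f@_b * (b == a)%:R.
  rewrite {1}(mpolyE f) raddf_sum /=.
  by apply: eq_bigr => b _; rewrite mcoeffZ mcoeffX.
rewrite fE /grade_outside /mmap coef_sum raddf_sum -sumrMnl /=.
apply: eq_bigr => b _.
rewrite gX mulrA -polyCM coefCM coefXn mulr_natr mcoeffMn mcoeffCM mcoeffX.
have [->|_] := eqVneq b a; first by rewrite eq_sym.
by rewrite mulr0 !mul0rn.
Qed.

(** The exponents of the new indeterminate that occur in the graded polynomial
    are the outside degrees of the monomials of [f]. *)
Lemma face_prime_power_grade s m f :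
  face_prime_power s m f <->
  forall d, (d < m)%N -> (grade_outside s f)`_d = 0.
Proof.
split=> [If d dm | f0 a af].
  apply/mpolyP=> a; rewrite coef_grade_outside mcoeff0.
  have [ad|_] := eqVneq (outside_degree s a) d; last by rewrite mulr0n.
  have [/If|/memN_msupp_eq0 ->] := boolP (a \in msupp f); last by rewrite mul0rn.
  by rewrite ad leqNgt dm.
rewrite leqNgt; apply/negP=> /f0/(congr1 (mcoeff a)).
rewrite coef_grade_outside eqxx mcoeff0 => /eqP.
by apply/negP; rewrite -mcoeff_msupp.
Qed.

(** Powers of this prime are primary: after grading, the lowest coefficient of
    [g * f] is the product of the lowest coefficients, and that of [g] sits in
    degree 0. *)
Lemma face_prime_power_cancel s m g f :
  ~ face_prime_power s 1 g -> face_prime_power s m (g * f) ->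
  face_prime_power s m f.
Proof.
move=> Ng /face_prime_power_grade gf0; apply/face_prime_power_grade.
have g0 : (grade_outside s g)`_0 != 0.
  by apply/eqP=> g0; apply: Ng; apply/face_prime_power_grade => -[].
elim/ltn_ind=> d IHd dm; have := gf0 d dm.
have -> : grade_outside s (g * f) = grade_outside s g * grade_outside s f.
  by rewrite /grade_outside rmorphM.
rewrite coefM big_ord_recl subn0 big1 ?addr0.
  by move/eqP; rewrite mulf_eq0 (negPf g0) => /eqP.
move=> i _; have di : (d - lift ord0 i < d)%N.
  by rewrite ltn_subrL (leq_ltn_trans _ (ltn_ord i)).
by rewrite [X in _ * X](IHd _ di) ?mulr0 // (ltn_trans di).
Qed.

Lemma face_prime s : is_prime_ideal (face_prime_power s 1).
Proof.
split=> [|/(_ 0%MM)|f g fg]; first exact: face_prime_power_ideal.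
  rewrite msupp1 inE eqxx => /(_ isT); rewrite outside_degree_gt0.
  by case/fintype.subsetPn=> i; rewrite inE mnm0E.
have [/asboolP|/asboolP Nf] := boolP `[< face_prime_power s 1 f >].
  by left.
by right; apply: face_prime_power_cancel fg.
Qed.

End Monomials.

(** * Symbolic powers of Stanley-Reisner ideals *)

Section StanleyReisner.
Variables (K : fieldType) (v : nat) (D : {set {set 'I_v}}).
Hypothesis Dcomplex : simplicial_complex D.
Implicit Types (s t : {set 'I_v}) (a b : 'X_{1..v}) (f g : {mpoly K[v]}).

Definition facet s := maxset (fun t => t \in D) s.

Lemma stanley_reisner_idealP f :
  stanley_reisner_ideal K D f <->
  forall a, a \in msupp f -> mnm_support a \notin D.
Proof.
split.
  move: f; apply: ideal_gen_min; last first.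
    move=> _ [t tD ->] a.
    by rewrite set_monomialE msuppX inE => /eqP->; rewrite mnm_support_indicator.
  split=> [a|f g If Ig a|f g Ig a]; first by rewrite msupp0.
    by move/msuppD_le; rewrite mem_cat => /orP[/If|/Ig].
  move/msuppM_le/allpairsP => [[b c] /= [_ /Ig cD ->]].
  apply: contra cD => /Dcomplex; apply.
  by rewrite mnm_supportD finset.subsetUr.
move=> aD; rewrite (mpolyE f) big_seq.
have idI := ideal_gen_ideal
  [set f | exists2 t : {set 'I_v}, t \notin D & f = set_monomial K t].
apply: ideal_sum => // a /aD {}aD; have [_ _ IM] := idI.
have sup_a : (indicator_mnm (mnm_support a) <= a)%MM.
  by apply/mnm_lepP=> i; rewrite mnmE inE; case: (a i).
rewrite -(submK sup_a) mpolyXD -mul_mpolyC mulrA.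
apply: IM; apply: ideal_gen_sub; exists (mnm_support a) => //.
by rewrite set_monomialE.
Qed.

Lemma stanley_reisner_sub_face s :
  s \in D -> stanley_reisner_ideal K D `<=` face_prime_power s 1.
Proof.
move=> sD f /stanley_reisner_idealP If a /If; rewrite outside_degree_gt0.
by apply: contra => /Dcomplex; apply.
Qed.

(** This prime is $(I : x_s)$: multiplying a monomial by $x_s$ enlarges its
    support by [s], and by maximality the union is a face only if the support
    was already inside [s]. *)
Lemma facet_associated s : facet s ->
  associated_primes (stanley_reisner_ideal K D) (face_prime_power s 1).
Proof.
case/maxsetP=> sD smax; split; first exact: face_prime.
exists (set_monomial K s); rewrite set_monomialE; apply/seteqP; split=> g /=.
  move=> Ig; apply/stanley_reisner_idealP => a.
  rewrite (perm_mem (msuppMX _ _)) => /mapP[b /Ig bs ->].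
  rewrite mnm_supportD mnm_support_indicator; move: bs.
  rewrite outside_degree_gt0; apply: contra => /smax <-.
    exact: finset.subsetUr.
  exact: finset.subsetUl.
move/stanley_reisner_idealP=> Ig a ag; rewrite outside_degree_gt0.
apply: contraL (Ig (indicator_mnm s + a)%MM _).
  rewrite mnm_supportD mnm_support_indicator => /finset.setUidPl ->.
  by rewrite negbK.
by rewrite (perm_mem (msuppMX _ _)); apply/mapP; exists a.
Qed.

(** The indices of the variables outside an associated prime [(I : f)] form a
    facet. They span a face since the prime contains [I]; they cannot be
    enlarged because $x_k f$ lies in [I] for every other index $k$, while [f]
    has a monomial whose support is a face. *)
Lemma associated_prime_avoids_facet (P : set {mpoly K[v]}) :
  associated_primes (stanley_reisner_ideal K D) P ->
  exists2 s, facet s & ~ P (set_monomial K s).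
Proof.
case=> Pp [f PE]; have [_ P1 _] := Pp.
pose s : {set 'I_v} := [set i | `[< ~ P 'X_i >]]%SET.
have Ps : ~ P (set_monomial K s).
  by apply: prime_ideal_prod => // i; rewrite inE => /asboolP.
exists s => //.
have IP : stanley_reisner_ideal K D `<=` P.
  move=> g; rewrite PE /= mulrC; have [_ _ IM] := ideal_gen_ideal
    [set f | exists2 t : {set 'I_v}, t \notin D & f = set_monomial K t].
  exact: IM.
have sD : s \in D.
  apply: contra_notT Ps => sD; apply: IP; apply: ideal_gen_sub.
  by exists s.
have [a af aD] : exists2 a, a \in msupp f & mnm_support a \in D.
  apply: contrapT => noa; apply: P1; rewrite PE /= mul1r.
  apply/stanley_reisner_idealP=> a af; apply/negP=> aD.
  by apply: noa; exists a.
have ext k : k \notin s -> (k |: mnm_support a)%SET \notin D.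
  rewrite inE => /asboolPn/contrapT; rewrite PE /= mulrC.
  move/stanley_reisner_idealP/(_ (U_(k) + a)%MM).
  rewrite mnm_supportD mnm_support1; apply.
  by rewrite (perm_mem (msuppMX _ _)); apply/mapP; exists a.
have as_ : mnm_support a \subset s.
  apply/fintype.subsetP => k ka; apply/negPn/negP => /ext/negP; apply.
  by rewrite (finset.setUidPr _) // finset.sub1set.
apply/maxsetP; split=> // t tD st; apply/eqP; rewrite finset.eqEsubset st andbT.
apply/fintype.subsetP => k kt; apply/negPn/negP => /ext/negP; apply.
apply: Dcomplex tD _; rewrite finset.subUset finset.sub1set kt.
exact: fintype.subset_trans as_ st.
Qed.

(** For a facet [s], each variable outside [s] becomes an element of [I] once
    multiplied by $x_s$, so $x_s$ raised to [m] brings a monomial of outside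
    degree at least [m] into the [m]-th ordinary power. *)
Lemma facet_monomial_ideal_power s m a :
  facet s -> (m <= outside_degree s a)%N ->
  ideal_power (stanley_reisner_ideal K D) m (set_monomial K s ^+ m * 'X_[a]).
Proof.
case/maxsetP=> sD smax; elim: m a => [|m IHm] a ma; first exact: ideal_power0.
have := leq_ltn_trans (leq0n m) ma; rewrite outside_degree_gt0.
case/fintype.subsetPn=> i; rewrite inE -lt0n => ai si.
have ia : (U_(i) <= a)%MM.
  by apply/mnm_lepP=> j; rewrite mnm1E; case: eqP => // <-.
move: ma; rewrite -(submK ia) addmC mpolyXD exprS mulrACA => ma.
apply: ideal_powerS; last first.
  apply: IHm; rewrite -ltnS (leq_trans ma) // outside_degreeD -add1n leq_add2r.
  by rewrite -(mdeg1 i) outside_degree_le_mdeg.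
apply: ideal_gen_sub; exists (i |: s)%SET.
  apply: contra si => /smax <-; first exact: finset.setU11.
  exact: finset.subsetUr.
by rewrite /set_monomial big_setU1 //= mulrC.
Qed.

Lemma symbolic_power_stanley_reisner m f :
  symbolic_power (stanley_reisner_ideal K D) m f <->
  forall s, facet s -> face_prime_power s m f.
Proof.
have idIm : is_ideal (ideal_power (stanley_reisner_ideal K D) m).
  exact: ideal_gen_ideal.
split=> [Sf s fs | Ff P PI].
  have /(contracted_idealP _ idIm (face_prime K s)) [g Ng Igf] :=
    Sf _ (facet_associated fs).
  apply: face_prime_power_cancel Ng _; apply: face_prime_power_ideal_power Igf.
  by apply: stanley_reisner_sub_face; case/maxsetP: fs.
have [s fs Ns] := associated_prime_avoids_facet PI.
apply/contracted_idealP => //; first by case: PI.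
exists (set_monomial K s ^+ m); first by apply: prime_ideal_expr => //; case: PI.
rewrite (mpolyE f) big_seq mulr_sumr; apply: ideal_sum => // a af.
have [_ _ IM] := idIm; rewrite -mul_mpolyC mulrCA; apply: IM.
by apply: facet_monomial_ideal_power => //; apply: Ff.
Qed.

End StanleyReisner.

(** The hypothesis excludes the default value taken on the zero ideal. *)
Lemma initial_degreeP (K : fieldType) (v : nat) (I : set {mpoly K[v]}) f :
  I f -> f != 0 -> is_initial_degree I (initial_degree I).
Proof.
move=> If f0.
pose Q d := `[< exists f, [/\ I f, f != 0 & (msize f).-1 = d] >].
have exQ : exists d, Q d by exists (msize f).-1; apply/asboolP; exists f.
have [d /asboolP Qd dmin] := find_ex_minn exQ.
suff : is_initial_degree I d by move/(xgetI 0%N).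
split=> // g Ig g0; apply: dmin; apply/asboolP.
by exists g.
Qed.

(** * The bipyramid *)

Section Bipyramid.
Variable n : nat.
Hypothesis n_ge3 : (3 <= n)%N.

Lemma bipyramid_face_card s : s \in bipyramid_complex n -> (#|s| <= 2)%N.
Proof.
rewrite inE => /or3P[/eqP->|/existsP[i /eqP->]|].
- by rewrite cards0.
- by rewrite cards1.
case/existsP=> i /existsP[j /andP[_ /eqP->]].
by rewrite cards2; case: (_ != _).
Qed.

Lemma ordS_neq (i : 'I_n.+2) : i != ordS i.
Proof.
rewrite -val_eqE /=; case: i => i /=; rewrite ltnS leq_eqVlt.
case/predU1P=> [->|ilt]; first by rewrite modnn.
by rewrite modn_small // neq_ltn ltnSn.
Qed.

(** Consecutive indices modulo $n + 2$ are adjacent: the vertices in their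
    numerical order run along a Hamiltonian cycle. *)
Lemma bipyramid_edge_ordS (i : 'I_n.+2) : bipyramid_edge i (ordS i).
Proof.
rewrite /bipyramid_edge /bipyramid_arc /=; case: i => i /= ilt.
have [->|] := eqVneq i n.+1; first by rewrite modnn !eqxx !orbT.
have [->|ni ni1] := eqVneq i n.
  have n_gt0 : (0 < n)%N by apply: leq_trans n_ge3.
  by rewrite modn_small // !eqxx n_gt0 leqnn !orbT.
rewrite modn_small; last by rewrite ltnS ltn_neqAle ni1.
have iltn : (i < n)%N by rewrite ltn_neqAle ni -ltnS ltn_neqAle ni1 -ltnS.
by rewrite iltn eqxx; case: i {ilt ni ni1} iltn => //= ->.
Qed.

Lemma bipyramid_cycle_facet (i : 'I_n.+2) :
  facet (bipyramid_complex n) [set i; ordS i]%SET.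
Proof.
apply/maxsetP; split.
  rewrite inE; apply/or3P/Or33/existsP; exists i; apply/existsP; exists (ordS i).
  by rewrite bipyramid_edge_ordS eqxx.
move=> t /bipyramid_face_card t2 it; apply/eqP; rewrite eq_sym finset.eqEcard it.
by rewrite cards2 ordS_neq.
Qed.

(** Each of the $n + 2$ vertices is an endpoint of two edges of the cycle, hence
    lies outside the other $n$. *)
Lemma sum_outside_degree_cycle (a : 'X_{1..n.+2}) :
  (\sum_i outside_degree [set i; ordS i]%SET a = n * mdeg a)%N.
Proof.
have E (i : 'I_n.+2) :
    (outside_degree [set i; ordS i]%SET a + (a i + a (ordS i)) = mdeg a)%N.
  rewrite mdegE [RHS](bigID (fun k => k \in [set i; ordS i]%SET)) /= addnC.
  congr (_ + _)%N; last by apply: eq_bigl => k; rewrite inE.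
  by rewrite big_setU1 ?big_set1 // inE ordS_neq.
have : (\sum_(i < n.+2) mdeg a = n.+2 * mdeg a)%N.
  by rewrite sum_nat_const card_ord.
rewrite -(eq_bigr _ (fun i _ => E i)).
have aS : (\sum_(i < n.+2) a (ordS i) = mdeg a)%N.
  by rewrite mdegE [RHS](reindex_inj (@ordS_inj _)).
by rewrite !big_split /= aS -mdegE; lia.
Qed.

(** Any exponent $k$ with $n k \geq m$ would do; $\lfloor m / n \rfloor + 1$ is
    within a constant of the optimum. *)
Lemma bipyramid_monomial_symbolic_power (K : fieldType) m :
  symbolic_power (stanley_reisner_ideal K (bipyramid_complex n)) m
    'X_[[multinom (m %/ n).+1 | _ < n.+2]].
Proof.
apply/symbolic_power_stanley_reisner; first exact: graph_complexP.
move=> s /maxsetP[/bipyramid_face_card s2 _] a; rewrite msuppX inE => /eqP ->.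
rewrite /outside_degree; under eq_bigr do rewrite mnmE.
have cs : (n <= #|~: s|)%N by rewrite cardsCs card_ord finset.setCK; lia.
rewrite sum_nat_const (leq_trans _ (leq_mul cs (leqnn _))) // mulnC.
by rewrite ltnW // ltn_ceil // (leq_trans _ n_ge3).
Qed.

Lemma bipyramid_initial_degree_bounds (K : fieldType) m d :
  d = initial_degree
    (symbolic_power (stanley_reisner_ideal K (bipyramid_complex n)) m) ->
  (m * (n + 2) <= n * d <= (m + n) * (n + 2))%N.
Proof.
move=> dE.
have Sx := bipyramid_monomial_symbolic_power (K := K) m.
have X0 : 'X_[[multinom (m %/ n).+1 | _ < n.+2]] != 0 :> {mpoly K[n.+2]}.
  by rewrite -msupp_eq0 msuppX.
have [[f [Sf f0 fd]] dmin] := initial_degreeP Sx X0; rewrite -dE in fd dmin.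
apply/andP; split; last first.
  have := dmin _ Sx X0; rewrite mmeasureX /= mdegE.
  under eq_bigr do rewrite mnmE.
  rewrite sum_nat_const card_ord => dle.
  have := leq_divM m n; nia.
have [a af] : exists a, a \in msupp f.
  case E: (msupp f) => [|a r]; first by rewrite -msupp_eq0 E in f0.
  by exists a; rewrite mem_head.
have ad : (mdeg a <= d)%N.
  by rewrite -fd -ltnS (leq_trans (msize_mdeg_lt af)) // leqSpred.
apply: (@leq_trans (n * mdeg a)); last by rewrite leq_mul2l ad orbT.
rewrite -sum_outside_degree_cycle addn2 mulnC -[n.+2 in leqLHS]card_ord.
rewrite -sum_nat_const; apply: leq_sum => i _.
move/(symbolic_power_stanley_reisner (@graph_complexP _ _)): Sf => Sf.
exact: Sf (bipyramid_cycle_facet i) a af.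
Qed.

End Bipyramid.

Theorem theorem3p2 (R : realType) (K : fieldType) (n : nat) (hn : (3 <= n)%N) :
  cvgn (waldschmidt_seq R (stanley_reisner_ideal K (bipyramid_complex n))) /\
  waldschmidt_constant R (stanley_reisner_ideal K (bipyramid_complex n)) =
    (n + 2)%:R / n%:R.
Proof.
have n0 : 0 < n%:R :> R by rewrite ltr0n (leq_trans _ hn).
suff cv : waldschmidt_seq R (stanley_reisner_ideal K (bipyramid_complex n)) @ \oo
    --> ((n + 2)%:R / n%:R : R).
  by split; [apply/cvg_ex; exists ((n + 2)%:R / n%:R : R) | apply: cvg_lim].
(* The shift discards the index 0, where the sequence divides by zero. *)
rewrite -cvg_shiftS /=.
apply: (@squeeze_cvgr _ _ _ _ (fun=> (n + 2)%:R / n%:R : R)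
  (fun m => (n + 2)%:R / n%:R + (n + 2)%:R * harmonic m : R)).
- apply: nearW => m; rewrite /waldschmidt_seq; set d := initial_degree _.
  have /andP[lo hi] := bipyramid_initial_degree_bounds hn (erefl d).
  have m0 : 0 < m.+1%:R :> R by rewrite ltr0n.
  have -> : (n + 2)%:R / n%:R + (n + 2)%:R * harmonic m =
      (m.+1 + n)%:R * (n + 2)%:R / n%:R / m.+1%:R :> R.
    by rewrite /harmonic /= natrD; field; rewrite nat1r !gt_eqF.
  rewrite ler_pdivlMr // ler_pdivrMr // mulrAC ler_pdivrMr //.
  rewrite divfK ?gt_eqF // ler_pdivlMr // -!natrM !ler_nat.
  by rewrite [((n + 2) * _)%N]mulnC [(d * n)%N]mulnC lo.
- exact: cvg_cst.
- rewrite -[X in _ --> X]addr0 -[X in _ --> _ + X](mulr0 (n + 2)%:R).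
  by apply: cvgD; [exact: cvg_cst | apply: cvgMr; exact: cvg_harmonic].
Qed.
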